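(* For any integers $n \geq 1$ and $k \geq 0$, let $w_0 = (n, n - 1, \ldots, 2, 1) \in \mathfrak{S}_n$ denote the longest word and let $f_{n,k} =|\mathcal{O}^{-1}_{\mathrm{CPF}_n(k)}(w_0)|$ denote the size of its fiber under the $k$-cascading parking rule. Let $C_n=\frac{1}{n+1}\binom{2n}{n}$ denote the $n$th Catalan number. Then: 1. $f_{n, 0} = 1$ for all $n \geq 1$. 2. $f_{n, 1} = M_n = \sum_{\ell = 0}^{\lfloor n/2 \rfloor} \frac{1}{\ell + 1} \binom{n}{2 \ell}\binom{2\ell}{\ell}$ for all $n \geq 1$ (the Motzkin numbers). 3. For all $n \geq 1$, $$f_{n, 2} = f_{n - 1, 2} + f_{n - 2, 2} + 2 \sum_{i=0}^{n-3}f_{i,2}f_{n-3-i,2} + \sum_{i=0}^{n-4} \left(\sum_{j=0}^i f_{j,2} f_{i-j,2}\right) f_{n-4-i,2},$$ where $f_{0,2} = 1$ (and $f_{m,2}=0$ for $m<0$). This is an offset of the sequence $(a_n)_{n\ge 0}$ (OEIS A101785) whose generating function $A(x)=\sum_{n\ge 0}a_nx^n$ is the formal power series determined by $A(x)=1+\frac{xA(x)}{1-x^2A(x)^2}$; namely $f_{n,2}=a_{n+1}$ for all $n\ge 0$. 4. $f_{n, n - 2} = C_n - C_{n-2}$ for all $n \geq 2$. 5. $f_{n, k} = C_n$ for all $n \geq 1$ and $k \geq n - 1$.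
   Context: There are $n$ cars, numbered $1,\dots,n$, entering in this order a one-way street with parking spots $1,2,\dots,n$ (in this order along the street). A preference tuple is $\alpha=(a_1,\dots,a_n)\in[n]^n$, where $[n]=\{1,\dots,n\}$ and $a_i$ is the preferred spot of car $i$. $k$-cascading parking rule ($k\ge 0$ an integer): when car $i$ enters, if spot $a_i$ is available it parks there. If spot $a_i$ is occupied and $k\geq 1$, car $i$ parks in spot $a_i$ and bumps the car occupying it out of it; the bumped car attempts to park in the spot immediately after the one it was bumped from: if that spot is available it parks there; if it is occupied and fewer than $k$ bumps have occurred since the arrival of car $i$, it parks there and bumps the car occupying it, which then attempts to park in the next spot in the same way, and so on. Once $k$ bumps have occurred, the last displaced car continues down the street without bumping any more cars and parks in the first unoccupied spot it encounters, if any. A car that runs past spot $n$ fails to park. For $k=0$ no bumping occurs and a car finding its preferred spot occupied continues forward to the first available spot. $\alpha$ is a $k$-cascading parking function if all cars can park under this rule; $\mathrm{CPF}_n(k)$ is the set of $k$-cascading parking functions of length $n$. The outcome of $\alpha\in\mathrm{CPF}_n(k)$ is the permutation $\pi=(\pi_1,\dots,\pi_n)\in\mathfrak{S}_n$ (permutations of $[n]$, one-line notation) such that $\pi_i=j$ means that car $j$ is parked in spot $i$ at the end of the process. $\mathcal{O}^{-1}_{\mathrm{CPF}_n(k)}(\pi)$ denotes the set of $\alpha\in\mathrm{CPF}_n(k)$ whose outcome (under the $k$-cascading rule) is $\pi$. Empty sums are $0$. *)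

(* Defs.v *)
From HB Require Import structures.
From mathcomp Require Import all_boot all_order all_fingroup all_algebra.

Set Implicit Arguments.
Unset Strict Implicit.
Unset Printing Implicit Defensive.

Import GRing.Theory.
Local Open Scope ring_scope.

(* Cars and spots 1, ..., n are represented by 0, ..., n-1 : 'I_n.
   A street is the list of its spots in order, [Some c] being a spot occupied
   by car [c] and [None] an unoccupied one. *)
Definition street (n : nat) := seq (option 'I_n).

(* Car [c] attempts to park in the first spot of [s], the portion of the street
   still ahead, when [b] more bumps are allowed since the current arrival.
   The result is the updated portion, or [None] if a car runs past the end. *)
Fixpoint advance (n b : nat) (c : 'I_n) (s : street n) : option (street n) :=
  match s with
  | [::] => None
  | None :: s' => Some (Some c :: s')
  | Some d :: s' =>
      if b is b'.+1 then omap (cons (Some c)) (advance b' d s')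
      else omap (cons (Some d)) (advance 0 c s')
  end.

Definition arrive (n k : nat) (c a : 'I_n) (s : street n) : option (street n) :=
  omap (cat (take a s)) (advance k c (drop a s)).

Definition park (n k : nat) (alpha : n.-tuple 'I_n) : option (street n) :=
  foldl (fun st c => obind (arrive k c (tnth alpha c)) st)
        (Some (nseq n None)) (enum 'I_n).

Definition CPF (n k : nat) : {set n.-tuple 'I_n} :=
  [set alpha | park k alpha != None].

Definition has_outcome (n k : nat) (alpha : n.-tuple 'I_n) (pi : 'S_n) : bool :=
  if park k alpha is Some s then [forall i : 'I_n, nth None s i == Some (pi i)]
  else false.

Definition fiber (n k : nat) (pi : 'S_n) : {set n.-tuple 'I_n} :=
  [set alpha in CPF n k | has_outcome k alpha pi].

Definition longest_word (n : nat) : 'S_n := perm (@rev_ord_inj n).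

Definition fiber_size (n k : nat) : nat := #|fiber k (longest_word n)|.

Definition fiber_size_int (m : int) (k : nat) : nat :=
  match m with Posz n => fiber_size n k | Negz _ => 0%N end.

Definition catalan (n : nat) : rat := (n.+1%:R)^-1 * ('C(2 * n, n))%:R.

Definition motzkin (n : nat) : rat :=
  \sum_(0 <= l < (n./2).+1)
    (l.+1%:R)^-1 * ('C(n, 2 * l))%:R * ('C(2 * l, l))%:R.

(* Formal power series, given by their coefficients. *)
Definition fps := nat -> rat.

Definition fps_one : fps := fun n => (n == 0%N)%:R.
Definition fps_X : fps := fun n => (n == 1%N)%:R.
Definition fps_add (u v : fps) : fps := fun n => u n + v n.
Definition fps_sub (u v : fps) : fps := fun n => u n - v n.
Definition fps_mul (u v : fps) : fps := fun n => \sum_(i < n.+1) u i * v (n - i)%N.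

(* The first n.+1 coefficients of 1/u, obtained from the vanishing of the
   positive-degree coefficients of u * (1/u); meaningful when u 0 != 0. *)
Fixpoint fps_inv_seq (u : fps) (n : nat) : seq rat :=
  if n is m.+1 then
    let s := fps_inv_seq u m in
    rcons s (- ((u 0%N)^-1 * \sum_(i < n) u (n - i)%N * s`_i))
  else [:: (u 0%N)^-1].

Definition fps_inv (u : fps) : fps := fun n => (fps_inv_seq u n)`_n.
Definition fps_div (u v : fps) : fps := fps_mul u (fps_inv v).

(* A = 1 + x A / (1 - x^2 A^2) *)
Definition A101785_equation (A : fps) : Prop :=
  A =1 fps_add fps_one
         (fps_div (fps_mul fps_X A)
                  (fps_sub fps_one
                           (fps_mul (fps_mul fps_X fps_X) (fps_mul A A)))).

(* Main.v *)
Require Import Defs.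
From HB Require Import structures.
From mathcomp Require Import all_boot all_order all_fingroup all_algebra.
From mathcomp Require Import zify ring.
Import GRing.Theory Num.Theory.
Set Implicit Arguments.
Unset Strict Implicit.
Unset Printing Implicit Defensive.

(** The fiber of the decreasing outcome is counted by undoing the arrivals,
    latest car first.

    Let k >= 1.  A car that has just arrived occupies its preferred spot, so the
    street after an arrival determines the preference.  It does not determine
    the spot that this arrival filled: that can be any spot of the occupied run
    starting at the newcomer, and each choice gives exactly one earlier street
    ([undo], [arrive_undo]).  In that earlier street the bumped cars stand one
    spot further back, and the car that finally filled the free spot stands at
    the k-th place of the cascade, or right before the free spot if fewer than
    k bumps occurred.  Iterating gives the recursion [histories]
    for the number of preference tuples leading to a street, and
    [num_ways_histories] shows that it counts them.

    Two principles keep this recursion within few shapes of blocks.  A free spot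
    separates its two sides, since undoing never reaches across it
    ([histories_catN]).  A car older than all the cars behind it can be removed
    from the front of a street ([histories_first]): it is never undone before
    them, and no undoing of theirs moves it.

    Consider a decreasing block of size n, its latest car first.  The spot freed
    by undoing that car splits the other n - 1 cars in two.  If at most k cars
    shifted, both parts are decreasing; if k >= n - 1 this always happens, and
    the Catalan convolution results.  If more cars shifted, the oldest car of
    the first part sits at its k-th place instead of at its end.  For k = 1 it
    is then in front and can be removed, which gives the Motzkin recursion.  For
    k = 2 it is second; undoing the car before it leads to blocks whose front
    cars can all be removed, which gives the recursion of the third item.  For
    k = n - 2 this happens in a single term of the convolution, for a block
    whose last two cars are exchanged, and such blocks are counted by
    differences of consecutive Catalan numbers ([block_histories_swap]).  For
    k = 0 each arrival can be undone in one way only.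

    As for the power series, write F for the generating function of the
    f_(n,2) and A = 1 + x F.  The equation A = 1 + x A / (1 - x^2 A^2) says that
    F = A / (1 - x^2 A^2), or F = A + x^2 A^2 F, and expanding A turns this into
    the recursion of the third item. *)

(** * Catalan and Motzkin numbers *)

Section CatalanMotzkin.
Local Open Scope ring_scope.

Lemma catalan0 : catalan 0 = 1.
Proof. by rewrite /catalan muln0 bin0 invr1 mulr1. Qed.

Lemma catalan_step n :
  n.+2%:R * catalan n.+1 = (4 * n + 2)%:R * catalan n.
Proof.
(* Pascal's rule, the two terms being equal by symmetry *)
have e1 : ('C(2 * n.+1, n.+1) = 2 * 'C((2 * n).+1, n.+1))%N.
  have -> : (2 * n.+1 = (2 * n).+2)%N by lia.
  rewrite binS -[in X in (_ + X)%N]bin_sub; last by lia.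
  have -> : ((2 * n).+1 - n = n.+1)%N by lia.
  by lia.
have e2 : (n.+1 * 'C((2 * n).+1, n.+1) = (2 * n).+1 * 'C(2 * n, n))%N.
  by rewrite -mul_bin_diag.
have e3 : (n.+1 * 'C(2 * n.+1, n.+1) = (4 * n + 2) * 'C(2 * n, n))%N.
  by rewrite e1; nia.
rewrite /catalan mulrA mulfV ?pnatr_eq0 // mul1r mulrCA -natrM -e3 natrM.
by rewrite mulrA mulVf ?pnatr_eq0 // mul1r.
Qed.

(** The weights i and n - i play symmetric roles in a convolution square. *)
Lemma conv_weight (c : nat -> rat) n :
  2 * (\sum_(i < n.+1) i%:R * (c i * c (n - i)%N)) =
  n%:R * \sum_(i < n.+1) c i * c (n - i)%N.
Proof.
rewrite mulr2n mulrDl mul1r {1}(reindex_inj rev_ord_inj) -big_split /=.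
rewrite mulr_sumr; apply: eq_bigr => i _; rewrite subSS subKn ?leq_ord //.
by rewrite natrB ?leq_ord //; ring.
Qed.

(** The sum of (i + 1) C_i C_(n+1-i) is evaluated in two ways: by the symmetry
    of [conv_weight], and by trading (i + 1) C_i for (4 i - 2) C_(i-1) with
    [catalan_step].  This expresses a convolution square through the previous
    one, and C_(n+2) satisfies the same relation. *)
Lemma catalan_rec n :
  catalan n.+1 = \sum_(i < n.+1) catalan i * catalan (n - i)%N.
Proof.
elim: n => [|n ih].
  have := catalan_step 0; rewrite big_ord1 catalan0 => h.
  have : 2 * catalan 1 = 2 * (1 * 1) by rewrite h.
  by apply: mulfI.
set S1 := RHS.
have w := conv_weight catalan n.+1; rewrite -/S1 in w.
have w0 := conv_weight catalan n; rewrite -ih in w0.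
have e : (n.+3)%:R * S1 = n.+3%:R * catalan n.+2.
  rewrite catalan_step.
  suff : 2 * (\sum_(i < n.+2) i.+1%:R * (catalan i * catalan (n.+1 - i)%N)) =
      (4 * n.+1 + 2)%:R * catalan n.+1.
    have -> : \sum_(i < n.+2) i.+1%:R * (catalan i * catalan (n.+1 - i)%N) =
      \sum_(i < n.+2) i%:R * (catalan i * catalan (n.+1 - i)%N) + S1.
      by rewrite /S1 -big_split; apply: eq_bigr => i _ /=; rewrite -natr1; ring.
    by move=> <-; rewrite mulrDr w -(natr1 n.+2) -(natr1 n.+1); ring.
  rewrite big_ord_recl subn0 catalan0 /=.
  have -> : \sum_(i < n.+1) (bump 0 i).+1%:R *
      (catalan (bump 0 i) * catalan (n.+1 - bump 0 i)%N) =
      4 * (\sum_(i < n.+1) i%:R * (catalan i * catalan (n - i)%N)) +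
      2 * catalan n.+1.
    rewrite ih !mulr_sumr -big_split /=; apply: eq_bigr => i _.
    rewrite /bump leq0n add1n subSS mulrA catalan_step natrD natrM; ring.
  have -> : forall x y : rat, 2 * (1%:R * (1 * x) + (4 * y + 2 * x)) =
     6 * x + 4 * (2 * y) by move=> x y; ring.
  by rewrite w0 natrD natrM -(natr1 n); ring.
by move: e => /mulfI ->; rewrite // pnatr_eq0.
Qed.

Lemma catalan1 : catalan 1 = 1.
Proof. by rewrite catalan_rec big_ord1 catalan0 mulr1. Qed.

Lemma sum_bin_bin m a b :
  (\sum_(i < m.+1) 'C(i, a) * 'C(m - i, b) = 'C(m.+1, (a + b).+1))%N.
Proof.
elim: m a b => [|m ih] a b.
  rewrite big_ord1 /=; case: a => [|a]; last by rewrite bin0n mul0n bin_small.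
  by case: b => [|b]; rewrite // bin0n muln0 bin_small.
rewrite big_ord_recr /= subnn; case: b => [|b].
  rewrite bin0 muln1 binS addn0; congr (_ + _)%N.
  rewrite -[in RHS](addn0 a) -ih; apply: eq_bigr => i _; by rewrite !bin0.
rewrite bin0n muln0 addn0 addnS binS -!ih -addnS -ih -big_split /=.
apply: eq_bigr => i _; rewrite subSn ?leq_ord // binS; lia.
Qed.

(** Terms beyond n / 2 vanish, so several Motzkin numbers can be written as sums
    over one common range. *)
Lemma motzkinE n N : (n./2 < N)%N ->
  motzkin n = \sum_(l < N) 'C(n, 2 * l)%:R * catalan l.
Proof.
move=> hN; rewrite /motzkin big_mkord (big_ord_widen N
  (fun l => (l.+1%:R)^-1 * ('C(n, 2 * l))%:R * ('C(2 * l, l))%:R)) //.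
rewrite [RHS](bigID (fun l : 'I_N => (l < n./2.+1)%N)) /= [X in _ + X]big1.
  by rewrite addr0; apply: eq_bigr => l _; rewrite /catalan; ring.
by move=> l; rewrite -leqNgt => hl; rewrite bin_small ?mul0r //; lia.
Qed.

Lemma sum_antidiagonal N (c g : nat -> rat) :
  (forall l, (N <= l)%N -> g l = 0) ->
  \sum_(i < N) \sum_(j < N) c i * c j * g (i + j)%N =
  \sum_(l < N) (\sum_(i < l.+1) c i * c (l - i)%N) * g l.
Proof.
move=> hg.
transitivity (\sum_(i < N) \sum_(l < N | (i <= l)%N) c i * c (l - i)%N * g l).
  apply: eq_bigr => i _.
  rewrite -(big_mkord predT (fun j => c i * c j * g (i + j)%N)).
  rewrite (big_cat_nat (n := N - i)) ?leq_subr //= [X in _ + X]big_nat_cond.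
  rewrite [X in _ + X]big1 ?addr0 => [|j]; last first.
    by rewrite andbT => hj; rewrite hg ?mulr0 //; lia.
  rewrite -(big_mkord (fun l => (i <= l)%N) (fun l => c i * c (l - i)%N * g l)).
  rewrite [RHS](big_cat_nat (n := i)) ?(ltnW (ltn_ord i)) //=.
  rewrite [X in X + _]big_nat_cond [X in X + _]big1 ?add0r => [|j]; last by lia.
  have := big_addn 0 N i (fun l => (i <= l)%N) (fun l => c i * c (l - i)%N * g l).
  rewrite add0n => ->; rewrite big_nat_cond [RHS]big_nat_cond.
  apply: eq_big => j; first by rewrite leq_addl andbT.
  by move=> _; rewrite addnK (addnC i).
rewrite (exchange_big_dep predT) //=; apply: eq_bigr => l _.
rewrite mulr_suml [RHS](big_ord_widen N (fun i => c i * c (l - i)%N * g l)) //.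
Qed.

Lemma motzkin0 : motzkin 0 = 1.
Proof. by rewrite (@motzkinE 0 1) // big_ord1 catalan0 bin0. Qed.

Lemma motzkin1 : motzkin 1 = 1.
Proof. by rewrite (@motzkinE 1 1) // big_ord1 catalan0 bin0. Qed.

(** The convolution square is a combination of the products C_l C_l', with
    coefficients evaluated by [sum_bin_bin].  They depend on l + l' only, so the
    Catalan convolution contracts the double sum to a single one; Pascal's rule
    produces the same sum from the difference of two Motzkin numbers. *)
Lemma motzkin_rec m : motzkin m.+2 =
  motzkin m.+1 + \sum_(i < m.+1) motzkin i * motzkin (m - i)%N.
Proof.
(* a bound above half of m + 2, common to all the Motzkin numbers involved *)
pose N := m.+2.
rewrite (@motzkinE m.+2 N.+1) ?(@motzkinE m.+1 N.+1); try by rewrite /N; lia.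
pose g l : rat := 'C(m.+1, (2 * l).+1)%:R.
have -> : \sum_(i < m.+1) motzkin i * motzkin (m - i)%N =
    \sum_(i < N) \sum_(j < N) catalan i * catalan j * g (i + j)%N.
  transitivity (\sum_(i < m.+1) \sum_(l < N) \sum_(l' < N)
     catalan l * catalan l' * ('C(i, 2 * l) * 'C(m - i, 2 * l'))%:R).
    apply: eq_bigr => i _.
    have hi := ltn_ord i.
    rewrite (@motzkinE i N) ?(@motzkinE (m - i) N); try by rewrite /N; lia.
    rewrite mulr_suml; apply: eq_bigr => l _; rewrite mulr_sumr.
    by apply: eq_bigr => l' _; rewrite natrM; ring.
  rewrite exchange_big; apply: eq_bigr => l _; rewrite exchange_big /=.
  apply: eq_bigr => l' _; rewrite -mulr_sumr /g mulnDr -sum_bin_bin.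
  by rewrite natr_sum.
rewrite sum_antidiagonal => [|l hl]; last first.
  by rewrite /g bin_small //; rewrite /N in hl; lia.
rewrite !(big_ord_recl N) /= !muln0 !bin0 -addrA; congr (_ + _).
rewrite -big_split /=; apply: eq_bigr => l _.
rewrite -catalan_rec /g /bump leq0n add1n.
have -> : (2 * l.+1 = (2 * l).+2)%N by lia.
by rewrite binS natrD; ring.
Qed.

End CatalanMotzkin.

(** * Undoing an arrival, and counting by undoing *)

Definition cars (T : eqType) (s : seq (option T)) : seq T := pmap id s.
Arguments cars : simpl never.

Fixpoint run (T : eqType) (v : seq (option T)) : seq T :=
  if v is Some d :: v' then d :: run v' else [::].

(** [x] lists the cars standing behind a newcomer after its arrival, up to the
    spot that this arrival filled; [unshift b x] lists the cars found before the
    arrival from the newcomer's spot on, when [b.+1] bumps are allowed.  The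
    first [b] cars of [x] were bumped by one spot.  The last car of [x] is the
    one that went on to the free spot: it came from the place reached by the
    last bump, and the cars between did not move. *)
Definition unshift (T : eqType) (b : nat) (x : seq T) : seq T :=
  take b x ++ rotr 1 (drop b x).
Arguments unshift : simpl never.

(** The parts of the street before the arrival of a newcomer, from its spot on,
    when [v] follows it afterwards.  The index [m] is the distance from the
    newcomer to the spot that was free. *)
Definition undo (T : eqType) (b : nat) (v : seq (option T)) :=
  [seq map Some (unshift b (take m (run v))) ++ None :: drop m v
    | m <- iota 0 (size (run v)).+1].

Arguments undo : simpl never.

(** The number of ways in which [s] can arise when [b.+1] bumps are allowed and
    [cs] lists the arrivals, latest first.  Cars absent from [s] are skipped, so
    that the function also applies to a piece of a street. *)
Fixpoint histories (T : eqType) (b : nat) (cs : seq T) (s : seq (option T)) :=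
  if cs is c :: cs' then
    if Some c \in s then
      \sum_(t <- undo b (drop (index (Some c) s).+1 s))
        histories b cs' (take (index (Some c) s) s ++ t)
    else histories b cs' s
  else 1%N.
Arguments histories : simpl never.

Section Streets.
Variable T : eqType.
Implicit Types (s u v t : seq (option T)) (w x y : seq T) (c d : T).

Lemma mem_cars c s : (c \in cars s) = (Some c \in s).
Proof. by rewrite /cars mem_pmap map_id. Qed.

Lemma cars_cat s t : cars (s ++ t) = cars s ++ cars t.
Proof. exact: pmap_cat. Qed.

Lemma cars_cons c s : cars (Some c :: s) = c :: cars s.
Proof. by []. Qed.

Lemma cars_consN s : cars (None :: s) = cars s.
Proof. by []. Qed.

Lemma cars_nil s : cars s = [::] -> s = nseq (size s) None.
Proof. by elim: s => // -[d|] s ih // /ih {1}->. Qed.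

Lemma cars_some w : cars (map Some w) = w.
Proof. by elim: w => //= d w; rewrite cars_cons => ->. Qed.

Lemma size_unshift b x : size (unshift b x) = size x.
Proof. by rewrite size_cat size_rotr -size_cat cat_take_drop. Qed.

Lemma perm_unshift b x : perm_eq (unshift b x) x.
Proof.
rewrite -[X in perm_eq _ X](cat_take_drop b) perm_cat2l.
by rewrite perm_rotr.
Qed.

Lemma unshift_small b x : (size x <= b.+1)%N -> unshift b x = x.
Proof.
move=> hx; rewrite /unshift.
have h: (size (drop b x) <= 1)%N by rewrite size_drop; lia.
suff -> : rotr 1 (drop b x) = drop b x by rewrite cat_take_drop.
by case: (drop b x) h => [|d []].
Qed.

Lemma unshift_cons b d x : unshift b.+1 (d :: x) = d :: unshift b x.
Proof. by []. Qed.

Lemma unshift0_rcons x d : unshift 0 (rcons x d) = d :: x.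
Proof. by rewrite /unshift take0 drop0 rotr1_rcons. Qed.

Lemma runE v : exists v', v = map Some (run v) ++ v' /\ run v' = [::].
Proof.
elim: v => [|[d|] v [v' [{1}-> h]]]; first by exists [::].
- by exists v'.
- by exists (None :: map Some (run v) ++ v').
Qed.

Lemma run_some x v : run (map Some x ++ v) = x ++ run v.
Proof. by elim: x => //= d x ->. Qed.

Lemma run_catN v s : run (v ++ None :: s) = run v.
Proof. by elim: v => [|[d|] v] //= ->. Qed.

Lemma size_run v : (size (run v) <= size v)%N.
Proof. by elim: v => [|[d|] v]. Qed.

Lemma mem_undo b v t :
  reflect (exists x v', v = map Some x ++ v' /\
                        t = map Some (unshift b x) ++ None :: v')
          (t \in undo b v).
Proof.
apply: (iffP mapP) => [[m]|[x [v' [-> ->]]]].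
- rewrite mem_iota add0n ltnS => /andP[_ hm] ->.
  have [v' [e _]] := runE v.
  exists (take m (run v)), (drop m v); split=> //.
  rewrite -{1}(cat_take_drop m v); congr (_ ++ _).
  by rewrite {1}e takel_cat ?size_map // map_take.
- exists (size x); first by rewrite mem_iota run_some size_cat; lia.
  by rewrite run_some take_size_cat // drop_size_cat // size_map.
Qed.

Lemma uniq_undo b v : uniq (undo b v).
Proof.
rewrite map_inj_in_uniq ?iota_uniq // => m1 m2.
rewrite !mem_iota !add0n !ltnS => h1 h2 /(congr1 (index None)).
have key y r : index None (map Some y ++ None :: r) = size y :> nat.
  by elim: y => //= d y ->.
by rewrite !key !size_unshift !size_takel //; lia.
Qed.

Lemma cars_undo b v t : t \in undo b v -> perm_eq (cars t) (cars v).
Proof.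
move=> /mem_undo[x [v' [-> ->]]].
by rewrite !cars_cat !cars_some cars_consN perm_cat2r perm_unshift.
Qed.

Lemma undo_catN b v s :
  undo b (v ++ None :: s) = [seq t ++ None :: s | t <- undo b v].
Proof.
rewrite /undo run_catN -map_comp; apply/eq_in_map => m.
rewrite mem_iota => /andP[_ hm] /=.
have ? := size_run v.
rewrite drop_cat -catA /=; case: ltnP => // h.
by rewrite (drop_oversize h) (_ : m - size v = 0)%N //; lia.
Qed.

Lemma histories_skip b c cs s :
  c \notin cars s -> histories b (c :: cs) s = histories b cs s.
Proof. by rewrite mem_cars {1}/histories => /negbTE ->. Qed.

Lemma histories_drop b cs1 cs s :
  all (fun c => c \notin cars s) cs1 ->
  histories b (cs1 ++ cs) s = histories b cs s.
Proof.
by elim: cs1 => // c cs1 ih /= /andP[h1 /ih h2]; rewrite histories_skip.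
Qed.

Lemma histories_cons b c cs u v : c \notin cars u ->
  histories b (c :: cs) (u ++ Some c :: v) =
  (\sum_(t <- undo b v) histories b cs (u ++ t))%N.
Proof.
rewrite mem_cars {1}/histories -/histories => h.
rewrite mem_cat inE eqxx orbT index_cat (negbTE h) /= eqxx addn0.
by rewrite take_size_cat // drop_cat ltnNge leqnSn /= subSnn /= drop0.
Qed.

Lemma split_car c s : c \in cars s -> uniq (cars s) ->
  exists u v, [/\ s = u ++ Some c :: v, c \notin cars u, c \notin cars v &
                  uniq (cars u ++ cars v)].
Proof.
rewrite mem_cars => /splitPr[u v]; rewrite cars_cat cars_cons.
rewrite uniq_catC /= mem_cat negb_or.
rewrite uniq_catC => /andP[/andP[h1 h2] h3].
by exists u, v; split.
Qed.

Lemma cat_car_inj c u v u' v' : c \notin cars u' -> c \notin cars v' ->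
  u ++ Some c :: v = u' ++ Some c :: v' -> u = u' /\ v = v'.
Proof.
move=> + hv; elim: u u' => [|z u ih] [|z' u'] hu //=.
- by case.
- by case=> ez _; move: hu; rewrite -ez cars_cons mem_head.
- by case=> _ ez; move: hv; rewrite -ez mem_cars mem_cat mem_head orbT.
case=> -> /ih[|-> ->] //; apply: contraNN hu.
by rewrite !mem_cars inE => ->; rewrite orbT.
Qed.

Lemma histories_empty b cs s : cars s = [::] -> histories b cs s = 1%N.
Proof. by move=> h; elim: cs => // c cs; rewrite histories_skip // h. Qed.

(** The run undone from a car on the left of the free spot stops there, and one
    undone from a car on the right starts after it. *)
Lemma histories_catN b cs s1 s2 : uniq (cars (s1 ++ s2)) ->
  histories b cs (s1 ++ None :: s2) =
  (histories b cs s1 * histories b cs s2)%N.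
Proof.
elim: cs s1 s2 => // c cs ih s1 s2; rewrite cars_cat => hu.
have [us1 us2] : uniq (cars s1) /\ uniq (cars s2).
  by move: hu; rewrite cat_uniq => /and3P[].
have [c1|c1] := boolP (c \in cars s1).
  have c2 : c \notin cars s2.
    by move: hu; rewrite cat_uniq => /and3P[_ /hasPn h _];
      apply/negP => /h; rewrite c1.
  have [u [v [e hcu hcv huv]]] := split_car c1 us1.
  rewrite e -catA /= in hu *.
  rewrite !(histories_cons b cs _ hcu) histories_skip //.
  rewrite undo_catN big_map big_distrl /= big_seq [RHS]big_seq.
  apply: eq_bigr => t ht; rewrite catA ih // cars_cat.
  have p : perm_eq ((cars u ++ cars t) ++ cars s2)
                   ((cars u ++ cars v) ++ cars s2).
    by rewrite perm_cat2r perm_cat2l (cars_undo ht).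
  rewrite cars_cat (perm_uniq p) -catA.
  move: hu; rewrite cars_cat cars_cons -catA uniq_catC /= => /andP[_].
  by rewrite uniq_catC.
have [c2|c2] := boolP (c \in cars s2); last first.
  by rewrite !histories_skip ?ih ?cars_cat // mem_cat negb_or c1.
have [u [v [e hcu hcv huv]]] := split_car c2 us2.
rewrite e in hu *.
rewrite -[LHS]/(histories b (c :: cs) (s1 ++ (None :: u) ++ Some c :: v)) catA.
rewrite histories_cons ?cars_cat ?mem_cat ?negb_or ?c1 //.
rewrite histories_skip // histories_cons // big_distrr /= big_seq [RHS]big_seq.
apply: eq_bigr => t ht; rewrite -catA /= ih //.
have p : perm_eq (cars s1 ++ cars u ++ cars t) (cars s1 ++ cars u ++ cars v).
  by rewrite !perm_cat2l (cars_undo ht).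
rewrite !cars_cat (perm_uniq p).
move: hu; rewrite !cars_cat cars_cons catA uniq_catC /= uniq_catC -catA.
by case/andP.
Qed.

(** The car [d] is the oldest of the street, so it stays in place while the
    other cars are undone one after the other; when its turn comes it stands
    alone and contributes the factor 1. *)
Lemma histories_first b cs d s :
  uniq (cars s) -> {subset cars s <= cs} ->
  {in cars s, forall e, (index e cs < index d cs)%N} ->
  histories b cs (Some d :: s) = histories b cs s.
Proof.
elim: cs s => // c cs ih s us ss hs.
have [ecd|ncd] := eqVneq c d.
  have s0 : cars s = [::].
    case e: (cars s) => [//|z zs].
    by have := hs z; rewrite e mem_head ecd /= eqxx ltn0 => /(_ isT).
  rewrite (histories_empty _ _ s0) ecd (histories_cons b cs (u := [::])) //.
  case: s s0 {us ss hs} => [|[z|] s] // s0; rewrite /undo /= big_seq1 /=;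
    exact: histories_empty.
have step s' : uniq (cars s') -> {subset cars s' <= cars s} -> c \notin cars s' ->
    histories b cs (Some d :: s') = histories b cs s'.
  move=> us' sub nc; apply: ih => // z hz.
    move: (ss z (sub z hz)); rewrite inE => /predU1P[ezc|//].
    by rewrite -ezc hz in nc.
  move: (hs z (sub z hz)) => /=; rewrite (negbTE ncd).
  by case: eqP => // ezc; rewrite ezc hz in nc.
have [hc|hc] := boolP (c \in cars s); last first.
  rewrite !histories_skip ?step //.
  by rewrite cars_cons inE negb_or ncd.
have [u [v [e hcu hcv huv]]] := split_car hc us.
rewrite e -cat_cons !histories_cons //; last first.
  by rewrite cars_cons inE negb_or ncd.
rewrite big_seq [RHS]big_seq; apply: eq_bigr => t ht.
have p : perm_eq (cars u ++ cars t) (cars u ++ cars v).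
  by rewrite perm_cat2l (cars_undo ht).
rewrite cat_cons step // ?cars_cat ?(perm_uniq p) //.
  move=> z; rewrite (perm_mem p) e cars_cat cars_cons !mem_cat.
  by rewrite inE => /orP[->|->]; rewrite ?orbT.
by rewrite (perm_mem p) mem_cat negb_or hcu.
Qed.

End Streets.

(** * Preference tuples are counted by histories *)

Section Parking.
Variable n : nat.
Implicit Types (c d a : 'I_n) (s t u v r : street n) (x y cs : seq 'I_n).

Lemma advance0_run x c v :
  advance 0 c (map Some x ++ None :: v) = Some (map Some x ++ Some c :: v).
Proof. by elim: x => //= d x ->. Qed.

Lemma advance0P c t r : advance 0 c t = Some r ->
  exists x v, t = map Some x ++ None :: v /\ r = map Some x ++ Some c :: v.
Proof.
elim: t r => [|[d|] t ih] r //=.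
  case e: (advance 0 c t) => [r'|] //= [<-].
  by have [x [v [-> ->]]] := ih _ e; exists (d :: x), v.
by move=> [<-]; exists [::], t.
Qed.

Lemma advance_unshift b x c v :
  advance b.+1 c (map Some (unshift b x) ++ None :: v) =
  Some (Some c :: map Some x ++ v).
Proof.
elim: b x c => [|b ih] x c.
  case/lastP: x => [|x d] //.
  by rewrite unshift0_rcons /= advance0_run /= map_rcons cat_rcons.
by case: x => [|d x] //; rewrite unshift_cons /= ih.
Qed.

Lemma advance_undo b c t r : advance b.+1 c t = Some r ->
  exists2 v, r = Some c :: v & t \in undo b v.
Proof.
elim: b c t r => [|b ih] c [|[d|] t] r //.
- rewrite /=; case e: (advance 0 d t) => [r'|] //= [<-].
  have [x [v [-> ->]]] := advance0P e.
  exists (map Some x ++ Some d :: v) => //.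
  apply/mem_undo; exists (rcons x d), v.
  by rewrite unshift0_rcons map_rcons cat_rcons.
- by case=> <-; exists t => //; apply/mem_undo; exists [::], t.
- rewrite -[LHS]/(omap (cons (Some c)) (advance b.+1 d t)).
  case e: (advance b.+1 d t) => [r'|] //= [<-].
  have [v -> /mem_undo[x [v' [-> ->]]]] := ih _ _ _ e.
  exists (Some d :: map Some x ++ v') => //.
  by apply/mem_undo; exists (d :: x), v'.
- by case=> <-; exists t => //; apply/mem_undo; exists [::], t.
Qed.

(** The newcomer stands exactly at its preferred spot, so the preference can be
    read off and the earlier street is recovered up to the choice in [undo]. *)
Lemma arrive_undo b c a s' u v :
  c \notin cars u -> c \notin cars v ->
  (arrive b.+1 c a s' == Some (u ++ Some c :: v)) =
  (a == size u :> nat) && (s' \in [seq u ++ t | t <- undo b v]).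
Proof.
move=> hu hv; apply/eqP/andP => [|[/eqP ea /mapP[t /mem_undo[x [v' [ev ->]]] ->]]].
  rewrite /arrive; case e: advance => [r|] // -[].
  have [v' -> ht] := advance_undo e => eu.
  have sa : size (take a s') = a.
    rewrite size_takel // leqNgt; apply/negP => /ltnW h.
    by move: e; rewrite drop_oversize.
  have [et ev] := cat_car_inj hu hv eu.
  split; first by rewrite -sa et.
  apply/mapP; exists (drop a s'); first by rewrite -ev.
  by rewrite -et cat_take_drop.
by rewrite /arrive ea take_size_cat // drop_size_cat // advance_unshift /= ev.
Qed.

(** The parking process restricted to the arrivals in [cs], which allows
    induction on the last arrival. *)
Definition park_along k cs (al : seq 'I_n) : option (street n) :=
  foldl (fun st ca => obind (arrive k ca.1 ca.2) st)
        (Some (nseq n None)) (zip cs al).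

Definition num_ways k m cs s : nat :=
  #|[set al : m.-tuple 'I_n | park_along k cs al == Some s]|.

Lemma park_along_rcons k cs c (al : seq 'I_n) a : size cs = size al ->
  park_along k (rcons cs c) (rcons al a) =
  obind (arrive k c a) (park_along k cs al).
Proof. by move=> h; rewrite /park_along zip_rcons // foldl_rcons. Qed.

(** If the last preference is forced to be [a0], counting tuples amounts to
    adding the counts of the possible earlier streets. *)
Lemma num_ways_rcons k m cs c s (a0 : 'I_n) (L : seq (street n)) :
  size cs = m -> uniq L ->
  (forall a s', (arrive k c a s' == Some s) = (a == a0) && (s' \in L)) ->
  num_ways k m.+1 (rcons cs c) s = \sum_(t <- L) num_ways k m cs t.
Proof.
move=> hm uL H.
(* appending the forced preference maps the tuples that lead to [L] onto
   the tuples that lead to [s] *)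
pose f (al : m.-tuple 'I_n) : m.+1.-tuple 'I_n := [tuple of rcons al a0].
have fi : injective f.
  by move=> x y /(congr1 val) /= /rcons_inj[/val_inj].
have -> : \sum_(t <- L) num_ways k m cs t =
    #|[set al : m.-tuple 'I_n | park_along k cs al \in map Some L]|.
  elim: L uL {H} => [|t L ih] /=.
    by rewrite big_nil => _; apply/esym/eqP; rewrite cards_eq0 -subset0;
      apply/subsetP => al; rewrite inE.
  move=> /andP[tL uL]; rewrite big_cons ih // /num_ways -cardsUI.
  set A := _ :|: _; rewrite [X in (_ + X)%N](_ : _ = 0%N) ?addn0.
    by congr #|pred_of_set _|; apply/setP => al; rewrite !inE.
  apply/eqP; rewrite cards_eq0 -subset0; apply/subsetP => al; rewrite !inE.
  move=> /andP[/eqP ->]; rewrite mem_map ?(negbTE tL) //.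
  by move=> ? ? [].
rewrite -(card_imset _ fi) /num_ways; congr #|pred_of_set _|.
apply/setP => al; rewrite inE; apply/idP/imsetP => [|[be]].
  have [be [a eal]] : exists be a, tval al = rcons be a.
    have := size_tuple al; case/lastP: (tval al) => // be a _.
    by exists be, a.
  have sb : size be == m.
    by have := size_tuple al; rewrite eal size_rcons => -[->].
  rewrite eal park_along_rcons ?(eqP sb) //.
  case e: (park_along k cs be) => [s'|] //=; rewrite H => /andP[/eqP ea sL].
  exists (Tuple sb); last by apply: val_inj; rewrite /= -ea -eal.
  by rewrite inE /= e mem_map // => ? ? [].
rewrite inE => hb -> /=; rewrite park_along_rcons ?size_tuple //.
case: (park_along k cs be) hb => [s'|] /=.
  by rewrite H eqxx mem_map // => ? ? [].
by move/mapP => [].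
Qed.

(** Both sides satisfy the same recursion on the last arrival, by
    [num_ways_rcons] and [arrive_undo]. *)
Lemma num_ways_histories b cs s :
  uniq cs -> size s = n -> perm_eq (cars s) cs ->
  num_ways b.+1 (size cs) cs s = histories b (rev cs) s.
Proof.
elim/last_ind: cs s => [|cs c ih] s.
  move=> _ hs /perm_nilP hc; rewrite histories_empty //.
  have -> : s = nseq n None by rewrite (cars_nil hc) hs.
  rewrite /num_ways -[RHS](expn0 #|{: 'I_n}|) -card_tuple -cardsT.
  congr #|pred_of_set _|; apply/setP => al; by rewrite !inE tuple0 eqxx.
rewrite rcons_uniq => /andP[ccs ucs] hs hp.
have us : uniq (cars s) by rewrite (perm_uniq hp) rcons_uniq ccs.
have hc : c \in cars s by rewrite (perm_mem hp) mem_rcons mem_head.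
have [u [v [e hcu hcv huv]]] := split_car hc us.
have hn : (size u < n)%N by move: hs; rewrite e size_cat /=; lia.
rewrite size_rcons (num_ways_rcons (a0 := Ordinal hn)
  (L := [seq u ++ t | t <- undo b v])) //.
- rewrite rev_rcons e histories_cons // big_map big_seq [RHS]big_seq.
  apply: eq_bigr => t ht; apply: ih => //.
    have/perm_size p := cars_undo ht.
    have [x [v' [ev et]]] := mem_undo _ _ _ ht.
    apply: etrans hs; rewrite e !size_cat /= ev et !size_cat /=.
    by rewrite !size_map size_unshift addnS.
  have h2 : perm_eq (cars u ++ cars v) cs.
    rewrite -(perm_cons c) -cat_cons -cat1s -catA perm_sym.
    rewrite perm_sym -(perm_catCA (cars u)) cat1s.
    by move: hp; rewrite e cars_cat cars_cons perm_sym perm_rcons perm_sym.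
  by rewrite cars_cat; apply: perm_trans h2; rewrite perm_cat2l (cars_undo ht).
- rewrite map_inj_uniq ?uniq_undo // => x y /eqP.
  by rewrite eqseq_cat // eqxx => /eqP.
- by move=> a s'; rewrite e arrive_undo // -val_eqE.
Qed.

Lemma park_alongE k (al : n.-tuple 'I_n) : park k al = park_along k (enum 'I_n) al.
Proof.
rewrite /park /park_along -[in RHS](map_tnth_enum al).
by elim: (enum 'I_n) (Some _) => //= c cs ih st; rewrite ih.
Qed.

Lemma size_advance b c s t : advance b c s = Some t -> size t = size s.
Proof.
elim: s b c t => [|[d|] s ih] b c t //=; last by case=> <-.
by case: b => [|b]; case e: advance => [r|] //= [<-] /=; rewrite (ih _ _ _ e).
Qed.

Lemma size_arrive k c a s t : arrive k c a s = Some t -> size t = size s.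
Proof.
rewrite /arrive; case e: advance => [r|] // -[<-].
by rewrite size_cat (size_advance e) -size_cat cat_take_drop.
Qed.

Lemma size_park_along k cs al s : park_along k cs al = Some s -> size s = n.
Proof.
rewrite /park_along; elim/last_ind: (zip cs al) s => [|zs z ih] s /=.
  by move=> [<-]; rewrite size_nseq.
rewrite foldl_rcons; case e: (foldl _ _ zs) => [s'|] //= /size_arrive ->.
exact: ih.
Qed.

Lemma fiber_size_num_ways k :
  fiber_size n k = num_ways k n (enum 'I_n) (map Some (rev (enum 'I_n))).
Proof.
rewrite /fiber_size /fiber /num_ways; congr #|pred_of_set _|; apply/setP => al.
rewrite !inE /has_outcome park_alongE.
case e: park_along => [s|] //=; have ss := size_park_along e.
rewrite -[RHS]/(s == _).
have nthrev (i : 'I_n) :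
    nth None (map Some (rev (enum 'I_n))) i = Some (rev_ord i).
  rewrite (nth_map i) ?size_rev ?size_enum_ord // nth_rev ?size_enum_ord //.
  by congr Some; apply: val_inj; rewrite /= nth_enum_ord //; have := ltn_ord i; lia.
apply/forallP/eqP => [h|-> i]; last by rewrite nthrev permE.
apply: (@eq_from_nth _ None); first by rewrite size_map size_rev size_enum_ord.
rewrite ss => i hi; have /eqP := h (Ordinal hi); rewrite permE /= => ->.
by have /= -> := nthrev (Ordinal hi).
Qed.

Lemma fiber_size_histories b :
  fiber_size n b.+1 =
  histories b (rev (enum 'I_n)) (map Some (rev (enum 'I_n))).
Proof.
rewrite fiber_size_num_ways -[X in num_ways _ X]size_enum_ord.
apply: num_ways_histories; first exact: enum_uniq.
  by rewrite size_map size_rev size_enum_ord.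
by rewrite cars_some perm_rev.
Qed.

(** Without bumps the newcomer [c] stands in front of all other cars only if it
    found its preferred spot free: driving on past occupied spots would leave a
    car in front of it. *)
Lemma arrive0_suffix j c a w s' : (j < n)%N -> c \notin w ->
  (arrive 0 c a s' == Some (nseq j None ++ Some c :: map Some w)) =
  (a == j :> nat) && (s' \in [:: nseq j.+1 None ++ map Some w]).
Proof.
move=> hj cw; rewrite inE; apply/eqP/andP => [|[/eqP ea /eqP ->]]; last first.
  by rewrite /arrive ea -addn1 nseqD -catA take_size_cat ?size_nseq //
    drop_size_cat ?size_nseq.
rewrite /arrive; case e: advance => [r|] // -[].
have [x [v [et ->]]] := advance0P e; rewrite catA => es.
have cN : c \notin cars (nseq j None : street n).
  by rewrite mem_cars mem_nseq andbF.
have := cat_car_inj cN _ es; rewrite cars_some => /(_ cw)[eu ev].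
case: x et eu {es} => [|d x] et.
  rewrite cats0 => eu; have sa : size (take a s') = a.
    rewrite size_takel // leqNgt; apply/negP => /ltnW h.
    by move: et; rewrite drop_oversize.
  split; first by rewrite -sa eu size_nseq.
  by rewrite -(cat_take_drop a s') eu et ev -addn1 nseqD -catA.
move=> eu; have : Some d \in (nseq j None : street n).
  by rewrite -eu mem_cat mem_head orbT.
by rewrite mem_nseq andbF.
Qed.

(** Cars arriving in increasing order fill the street from its end, each with a
    single choice. *)
Lemma num_ways0 cs : uniq cs -> (size cs <= n)%N ->
  num_ways 0 (size cs) cs (nseq (n - size cs) None ++ map Some (rev cs)) = 1%N.
Proof.
elim/last_ind: cs => [|cs c ih].
  move=> _ _; rewrite subn0 cats0 /num_ways -[RHS](expn0 #|{: 'I_n}|).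
  rewrite -card_tuple -cardsT.
  by congr #|pred_of_set _|; apply/setP => al; rewrite !inE tuple0 eqxx.
rewrite rcons_uniq size_rcons => /andP[ccs ucs] hs.
have hj : (n - (size cs).+1 < n)%N by lia.
rewrite (num_ways_rcons (a0 := Ordinal hj)
  (L := [:: nseq (n - (size cs).+1).+1 None ++ map Some (rev cs)])) //.
  by rewrite big_seq1 subnSK // ih // ltnW.
move=> a s'; rewrite rev_rcons arrive0_suffix //.
by rewrite mem_rev.
Qed.

Lemma fiber_size0 : fiber_size n 0 = 1%N.
Proof.
rewrite fiber_size_num_ways.
by have := num_ways0 (enum_uniq 'I_n); rewrite size_enum_ord subnn => ->.
Qed.

End Parking.

(** * Blocks of decreasing and nearly decreasing cars *)

Notation block_histories b cs w := (histories b cs (map Some w)).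

Section Blocks.
Variable T : eqType.
Implicit Types (cs w x y z : seq T) (c d : T).

Lemma block_histories_nil b cs : block_histories b cs [::] = 1%N.
Proof. exact: histories_empty. Qed.

Lemma block_histories_cons b c cs x : uniq (c :: x) ->
  block_histories b (c :: cs) (c :: x) =
  \sum_(0 <= m < (size x).+1)
    block_histories b cs (unshift b (take m x)) * block_histories b cs (drop m x).
Proof.
move=> /andP[cx ux].
rewrite map_cons (histories_cons b cs (u := [::])) // /undo.
have -> : run (map Some x) = x by rewrite -[map _ _]cats0 run_some cats0.
rewrite big_map big_seq /index_iota subn0 [RHS]big_seq; apply: eq_bigr => m _.
rewrite cat0s -map_drop histories_catN // cars_cat !cars_some.
have p : perm_eq (unshift b (take m x) ++ drop m x) x.
  by rewrite -{3}(cat_take_drop m x) perm_cat2r perm_unshift.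
by rewrite (perm_uniq p).
Qed.

(** In the lemmas on blocks, decreasing means being a subsequence of the list
    [cs] of arrivals, latest first.  The arrivals later than those of the block
    are dropped by this splitting. *)
Lemma subseq_cons_split c x cs : subseq (c :: x) cs -> uniq cs ->
  exists cs1 cs2, [/\ cs = cs1 ++ c :: cs2, subseq x cs2, uniq cs2 &
    {in c :: x, forall d, d \notin cs1}].
Proof.
elim: cs => // d cs ih /=; case: eqP => [<- sx|_ sx] /andP[dcs ucs].
  by exists [::], cs.
have [cs1 [cs2 [e s2 u2 h]]] := ih sx ucs.
exists (d :: cs1), cs2; split=> //; first by rewrite e.
move=> z hz; rewrite inE negb_or h // andbT.
by apply: contraNneq dcs => <-; exact: (mem_subseq sx).
Qed.

(** The cars of [y] may stand in any order, as only the latest car [c] is undone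
    here.  Each summand is a product since the freed spot separates. *)
Lemma block_histories_unfold b c x y cs :
  uniq cs -> subseq (c :: x) cs -> perm_eq y x ->
  exists cs', [/\ uniq cs', subseq x cs' &
    block_histories b cs (c :: y) =
    \sum_(0 <= m < (size x).+1)
      block_histories b cs' (unshift b (take m y)) *
      block_histories b cs' (drop m y)].
Proof.
move=> ucs sx pxy; have ux := subseq_uniq sx ucs.
have [cs1 [cs2 [-> s2 u2 h]]] := subseq_cons_split sx ucs.
have pc : perm_eq (c :: y) (c :: x) by rewrite perm_cons.
exists cs2; split=> //; rewrite histories_drop.
  by rewrite -(perm_size pxy) block_histories_cons // (perm_uniq pc).
apply/allP => d d1; rewrite cars_some (perm_mem pc).
by apply: contraL d1; exact: h.
Qed.

Lemma index_subseq_rcons x d e cs : uniq cs -> subseq (rcons x d) cs ->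
  e \in x -> (index e cs < index d cs)%N.
Proof.
elim: x cs => // z x ih cs ucs sx ex; rewrite rcons_cons in sx.
have := subseq_uniq sx ucs; rewrite /= mem_rcons inE negb_or => /andP[/andP[zd _] _].
have [cs1 [cs2 [-> s2 u2 h]]] := subseq_cons_split sx ucs.
rewrite !index_cat (negbTE (h e _)); last first.
  by move: ex; rewrite !inE mem_rcons inE orbCA => ->; rewrite orbT.
rewrite (negbTE (h d _)) ?inE ?mem_rcons ?mem_head ?orbT //=.
rewrite ltn_add2l (negbTE zd); case: eqP => // /eqP ne.
by rewrite ltnS; apply: ih => //; move: ex; rewrite inE eq_sym (negbTE ne).
Qed.

Lemma block_histories_first b x y d cs :
  uniq cs -> subseq (rcons x d) cs -> perm_eq y x ->
  block_histories b cs (d :: y) = block_histories b cs y.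
Proof.
move=> ucs sx pyx; have := subseq_uniq sx ucs; rewrite rcons_uniq => /andP[dx ux].
rewrite map_cons histories_first ?cars_some ?(perm_uniq pyx) //.
  move=> e; rewrite (perm_mem pyx) => ex.
  by apply: (mem_subseq sx); rewrite mem_rcons inE ex orbT.
by move=> e; rewrite (perm_mem pyx); exact: index_subseq_rcons.
Qed.

Lemma unshift0_take d x m : (m < size x)%N ->
  unshift 0 (take m.+1 x) = nth d x m :: take m x.
Proof. by move=> h; rewrite (take_nth d h) unshift0_rcons. Qed.

Local Open Scope ring_scope.

(** Within this size no cascade is ever cut short, so undoing keeps all parts
    decreasing. *)
Lemma block_histories_catalan b cs w : uniq cs -> subseq w cs ->
  (size w <= b.+2)%N -> (block_histories b cs w)%:R = catalan (size w).
Proof.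
have [n] := ubnP (size w); elim: n w cs => // n ih [|c x] cs.
  by rewrite block_histories_nil catalan0.
rewrite /= ltnS => hn ucs sx hb.
have [cs' [u' s' ->]] := block_histories_unfold b ucs sx (perm_refl x).
rewrite catalan_rec natr_sum big_mkord; apply: eq_bigr => m _.
have hm : (m <= size x)%N := leq_ord m.
have st : size (take m x) = m by rewrite size_takel.
rewrite natrM unshift_small ?st; last by lia.
by rewrite !ih ?size_drop ?st //; try lia;
  apply: subseq_trans s'; rewrite ?take_subseq ?drop_subseq.
Qed.

(** With one bump allowed, undoing moves the oldest car of the first part to its
    front, where [block_histories_first] removes it.  If no car shifted there is
    no oldest car to remove, hence the linear term of the recursion. *)
Lemma block_histories_motzkin cs w : uniq cs -> subseq w cs ->
  (block_histories 0 cs w)%:R = motzkin (size w).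
Proof.
have [n] := ubnP (size w); elim: n w cs => // n ih [|c x] cs.
  by rewrite block_histories_nil motzkin0.
rewrite /= ltnS => hn ucs sx.
have [cs' [u' s' ->]] := block_histories_unfold 0 ucs sx (perm_refl x).
rewrite big_nat_recl // take0 unshift_small // block_histories_nil mul1n.
rewrite drop0 natrD ih //.
case: x hn s' {sx} => [|d x] hn s'.
  by rewrite big_nil addr0 motzkin1 motzkin0.
rewrite motzkin_rec natr_sum big_mkord; congr (_ + _); apply: eq_bigr => m _.
have hm : (m < size (d :: x))%N by [].
have st : size (take m (d :: x)) = m by rewrite size_takel // ltnW.
have sr : subseq (rcons (take m (d :: x)) (nth d (d :: x) m)) cs'.
  by rewrite -take_nth //; apply: subseq_trans s'; exact: take_subseq.
rewrite natrM (unshift0_take d) // (block_histories_first 0 u' sr) // !ih //.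
- by rewrite st size_drop /= subSS.
- by rewrite size_drop /= in hn *; lia.
- by apply: subseq_trans s'; exact: drop_subseq.
- by rewrite st; move: hn hm => /=; lia.
- by apply: subseq_trans sr; exact: subseq_rcons.
Qed.

(** The convolution obtained by undoing the latest car has smaller blocks of the
    same shape as long as the freed spot leaves [x] and [y] on its right; the
    Catalan convolutions of the two terms on the right-hand side differ in the
    same way. *)
Lemma block_histories_swap b cs z (x y : T) :
  uniq cs -> subseq (z ++ [:: y; x]) cs ->
  (size z <= b)%N ->
  (block_histories b cs (z ++ [:: x; y]))%:R =
  catalan (size z).+2 - catalan (size z).+1.
Proof.
have [n] := ubnP (size z); elim: n z cs => // n ih [|c z] cs hn ucs sz hz /=.
  rewrite (@block_histories_first b [:: y] [:: y] x cs) // block_histories_catalan //.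
  by apply: subseq_trans sz; rewrite /= eqxx.
have p : perm_eq (z ++ [:: x; y]) (z ++ [:: y; x]).
  by rewrite perm_cat2l (perm_catC [:: x]).
have [cs' [u' s' ->]] := block_histories_unfold b ucs sz p.
have sz' : size (z ++ [:: y; x]) = (size z).+2 by rewrite size_cat /= addn2.
have szx : size (z ++ [:: x; y]) = (size z).+2 by rewrite size_cat /= addn2.
rewrite /= ltnS in hn hz.
have sb m : unshift b (take m (z ++ [:: x; y])) = take m (z ++ [:: x; y]).
  by apply: unshift_small; rewrite size_take szx; case: ifP; lia.
have szx' : subseq (z ++ [:: x]) cs'.
  apply: subseq_trans s'; rewrite cat_subseq // sub1seq !inE eqxx orbT //.
have sy : subseq [:: y] cs'.
  by apply: subseq_trans s'; rewrite sub1seq mem_cat !inE eqxx orbT.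
rewrite sz' big_nat_recr // big_nat_recr //= !sb -szx take_size drop_size.
rewrite block_histories_nil muln1 szx -cat_rcons -(size_rcons z x).
rewrite take_size_cat // drop_size_cat // cats1 in szx' *.
rewrite cat_rcons size_rcons !natrD natrM ih //; last by lia.
rewrite (block_histories_catalan u' szx') ?size_rcons; last by lia.
rewrite (block_histories_catalan u' sy) // catalan1.
have e3 : catalan (size z).+3 =
    \sum_(m < (size z).+1) catalan m * catalan ((size z).+2 - m)%N +
    catalan (size z).+1 + catalan (size z).+2.
  by rewrite catalan_rec 2!big_ord_recr /= subSnn subnn catalan1 catalan0 !mulr1.
have e2 : catalan (size z).+2 =
    \sum_(m < (size z).+1) catalan m * catalan ((size z).+1 - m)%N +
    catalan (size z).+1.
  by rewrite catalan_rec big_ord_recr /= subnn catalan0 !mulr1.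
suff e1 : (\sum_(0 <= m < (size z).+1)
      block_histories b cs' (unshift b (take m (z ++ [:: x; y]))) *
      block_histories b cs' (drop m (z ++ [:: x; y])))%N%:R =
    \sum_(m < (size z).+1) catalan m *
      (catalan ((size z).+2 - m)%N - catalan ((size z).+1 - m)%N).
  rewrite e1 e3 [X in _ = _ - X]e2; under eq_bigr do rewrite mulrBr.
  by rewrite sumrB; ring.
rewrite natr_sum big_mkord; apply: eq_bigr => m _; rewrite sb natrM.
have hm : (m <= size z)%N := leq_ord m.
have sm : size (take m z) = m by rewrite size_takel.
have sd : size (drop m z) = (size z - m)%N by rewrite size_drop.
have ed w : drop m (z ++ w) = drop m z ++ w.
  rewrite drop_cat; case: ltnP => // h.
  have -> : (m - size z = 0)%N by lia.
  by rewrite drop0 drop_oversize.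
rewrite takel_cat // block_histories_catalan ?sm //; last by lia.
  rewrite ed ih ?sd //; try by lia.
    by rewrite -!subSn //; apply: leqW.
  by rewrite -ed; apply: subseq_trans s'; exact: drop_subseq.
apply: subseq_trans s'; apply: subseq_trans (prefix_subseq _ _).
exact: take_subseq.
Qed.

(** Only the term of the convolution in which all other cars shifted differs
    from the Catalan case: there the last two cars get exchanged. *)
Lemma block_histories_almost_unbounded b cs w : uniq cs -> subseq w cs ->
  size w = b.+3 ->
  (block_histories b cs w)%:R = catalan b.+3 - catalan b.+1.
Proof.
case: w => [|c w] // ucs sw [sz].
have [z [y [x ew]]] : exists (z : seq T) (y x : T), w = z ++ [:: y; x].
  case/lastP: w sz {sw} => // w x; rewrite size_rcons => -[].
  case/lastP: w => // w y _; exists w, y, x.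
  by rewrite -cats1 cat_rcons.
have [cs' [u' s' ->]] := block_histories_unfold b ucs sw (perm_refl w).
have szb : size z = b by move: sz; rewrite ew size_cat /= addn2 => -[].
rewrite sz big_nat_recr //= -sz take_size drop_size block_histories_nil muln1.
have -> : unshift b w = z ++ [:: x; y].
  by rewrite ew -szb /unshift take_size_cat // drop_size_cat.
rewrite natrD (block_histories_swap u') -?ew ?szb //.
rewrite sz (catalan_rec b.+2) big_ord_recr /= subnn catalan0 mulr1 addrA.
congr (_ + _ - _); rewrite natr_sum big_mkord; apply: eq_bigr => m _.
have hm : (m <= b.+1)%N := leq_ord m.
have sm : size (take m w) = m by rewrite size_takel // sz; lia.
rewrite natrM unshift_small ?sm // !block_histories_catalan ?sm ?size_drop ?sz //;
  try lia.
- by apply: subseq_trans s'; exact: drop_subseq.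
- by apply: subseq_trans s'; exact: take_subseq.
Qed.

Local Close Scope ring_scope.

Lemma block_histories1 b cs d : d \in cs -> uniq cs ->
  block_histories b cs [:: d] = 1.
Proof.
move=> dcs ucs; rewrite (@block_histories_first b [::]) ?sub1seq //.
exact: block_histories_nil.
Qed.

(** This is the shape that a long cascade of two bumps leaves behind: the latest
    car [d], then the oldest car [e], then a decreasing rest.  Undoing [d] leaves
    [e] in front.  If the freed spot comes right before or right after [e], what
    remains is [x]; otherwise the oldest car of the shifted part of [x] comes
    right after [e], and both are removed from the front. *)
Lemma block_histories_top_bottom (f : nat -> nat) cs d e x :
  (forall cs' w, uniq cs' -> subseq w cs' -> size w <= size x ->
     block_histories 1 cs' w = f (size w)) ->
  uniq cs -> subseq (d :: rcons x e) cs ->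
  block_histories 1 cs [:: d, e & x] =
  2 * f (size x) + \sum_(0 <= i < size x) f i * f (size x - i.+1).
Proof.
move=> hf ucs sx.
have pe : perm_eq (e :: x) (rcons x e) by rewrite perm_sym perm_rcons.
have [cs' [u' s' ->]] := block_histories_unfold 1 ucs sx pe.
have sx' : subseq x cs' by apply: subseq_trans s'; exact: subseq_rcons.
have ecs : e \in cs' by apply: (mem_subseq s'); rewrite mem_rcons mem_head.
rewrite size_rcons !big_nat_recl // take0 unshift_small // block_histories_nil.
rewrite drop0 mul1n (block_histories_first 1 u' s') // hf //.
rewrite take_cons take0 drop_cons drop0 unshift_small // block_histories1 // hf //.
rewrite addnA mul1n addnn mul2n; congr (_ + _).
apply: eq_big_nat => i /andP[_ hi].
rewrite take_cons drop_cons unshift_cons (unshift0_take e) //.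
have s1 : subseq (rcons (take i x) (nth e x i)) cs'.
  by rewrite -take_nth //; apply: subseq_trans sx'; exact: take_subseq.
have s2 : subseq (rcons (take i.+1 x) e) cs'.
  apply: subseq_trans s'; rewrite -!cats1; apply: cat_subseq => //.
  exact: take_subseq.
have p2 : perm_eq (nth e x i :: take i x) (take i.+1 x).
  by rewrite (take_nth e hi) perm_sym perm_rcons.
rewrite (block_histories_first 1 u' s2 p2) (block_histories_first 1 u' s1) //.
have si : size (take i x) = i by rewrite size_takel // ltnW.
rewrite !hf ?si ?size_drop //; try lia.
- by apply: subseq_trans sx'; exact: drop_subseq.
- by apply: subseq_trans s1; exact: subseq_rcons.
Qed.

(** The factor [1 < n] implements f_(-1) = 0. *)
Definition cascade2_rec (f : nat -> nat) n :=
  f (n - 1) + (1 < n) * f (n - 2)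
  + 2 * (\sum_(0 <= i < n - 2) f i * f (n - 3 - i))
  + \sum_(0 <= i < n - 3)
      (\sum_(0 <= j < i.+1) f j * f (i - j)) * f (n - 4 - i).

(** The freed spot at distance 0 or 1 from the latest car gives the two linear
    terms; from distance 2 on, the first part has the shape treated in
    [block_histories_top_bottom]. *)
Lemma block_histories_cascade2 (f : nat -> nat) cs w :
  (forall cs' w', uniq cs' -> subseq w' cs' -> size w' < size w ->
     block_histories 1 cs' w' = f (size w')) ->
  uniq cs -> subseq w cs -> 0 < size w ->
  block_histories 1 cs w = cascade2_rec f (size w).
Proof.
case: w => // c x hf ucs sx _; rewrite /cascade2_rec /= subn1 /= in hf *.
have [cs' [u' s' ->]] := block_histories_unfold 1 ucs sx (perm_refl x).
rewrite big_nat_recl // take0 unshift_small // block_histories_nil drop0 mul1n.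
rewrite hf //.
case: x hf s' {sx} => [|d x] hf s'; first by rewrite !big_geq //= mul0n !addn0.
have dcs : d \in cs' by apply: (mem_subseq s'); rewrite mem_head.
have sx' : subseq x cs' by apply: subseq_trans s'; exact: subseq_cons.
rewrite -[size (d :: x)]/(size x).+1 [\sum_(0 <= i < (size x).+1) _]big_nat_recl //.
rewrite take_cons drop_cons take0 unshift_small // block_histories1 // drop0 hf //.
have -> : (size x).+2 - 2 = size x by lia.
have -> : (1 < (size x).+2) * f (size x) = f (size x) by rewrite mul1n.
rewrite -2!addnA; congr (_ + (_ + _)).
pose H t := 2 * f t + \sum_(0 <= i < t) f i * f (t - i.+1).
transitivity (\sum_(0 <= t < size x) H t * f (size x - t.+1)).
  apply: eq_big_nat => t /andP[_ ht].
  rewrite take_cons drop_cons unshift_cons (unshift0_take d) //.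
  have st : size (take t x) = t by rewrite size_takel // ltnW.
  rewrite (@block_histories_top_bottom f) ?st //.
  - rewrite hf ?size_drop //=; last by lia.
    by apply: subseq_trans sx'; exact: drop_subseq.
  - by move=> cs2 w u2 s2 h2; apply: hf => //=; lia.
  - rewrite -take_nth //; apply: subseq_trans s'; rewrite /= eqxx.
    exact: take_subseq.
have e3 : forall i, (size x).+2 - 3 - i = size x - i.+1 by move=> i; lia.
under eq_bigr do rewrite mulnDl.
rewrite big_split /= big_distrr /=; congr (_ + _).
  by apply: eq_bigr => i _; rewrite e3 mulnA.
case: (size x) => [|p]; first by rewrite !big_nil.
rewrite big_nat_recl // big_nil mul0n add0n.
have -> : p.+3 - 3 = p by lia.
apply: eq_bigr => i _; congr (_ * f _); last by lia.
Qed.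

End Blocks.

Lemma fiber_size_block n b : exists cs : seq 'I_n,
  [/\ uniq cs, size cs = n & fiber_size n b.+1 = block_histories b cs cs].
Proof.
exists (rev (enum 'I_n)); split; last exact: fiber_size_histories.
  by rewrite rev_uniq enum_uniq.
by rewrite size_rev size_enum_ord.
Qed.

(** The recursion determines the count from the sizes alone, so every decreasing
    block has as many histories as the full street of its size. *)
Lemma block_histories_fiber_size (T : eqType) (cs w : seq T) :
  uniq cs -> subseq w cs -> block_histories 1 cs w = fiber_size (size w) 2.
Proof.
have [n] := ubnP (size w); elim: n T cs w => // n ih T cs w.
rewrite ltnS => hn ucs sw.
move ew: (size w) => m; have [fcs [fu fs ->]] := fiber_size_block m 1.
have [m0|m0] := posnP m.
  by rewrite (size0nil (etrans ew m0)) (size0nil (etrans fs m0)) !block_histories_nil.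
rewrite (@block_histories_cascade2 T (fun l => fiber_size l 2)) ?ew //; last first.
  by move=> cs' w' u' s' h'; apply: ih => //; lia.
rewrite (@block_histories_cascade2 _ (fun l => fiber_size l 2) fcs) ?fs //.
by move=> cs' w' u' s' h'; apply: ih => //; lia.
Qed.

Lemma fiber_size2_rec n : 0 < n ->
  fiber_size n 2 = cascade2_rec (fun m => fiber_size m 2) n.
Proof.
move=> hn; have [cs [ucs scs ->]] := fiber_size_block n 1.
rewrite (@block_histories_cascade2 _ (fun m => fiber_size m 2)) ?scs //.
by move=> cs' w u s _; exact: block_histories_fiber_size.
Qed.

Lemma fiber_size_no_cars k : fiber_size 0 k = 1.
Proof.
case: k => [|b]; first exact: fiber_size0.
have [cs [_ /size0nil -> ->]] := fiber_size_block 0 b.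
exact: block_histories_nil.
Qed.

Local Open Scope ring_scope.

Lemma fiber_size_motzkin n : (fiber_size n 1)%:R = motzkin n.
Proof.
have [cs [u s ->]] := fiber_size_block n 0.
by rewrite block_histories_motzkin ?s.
Qed.

Lemma fiber_size_catalan n k : (n <= k.+1)%N -> (fiber_size n k)%:R = catalan n.
Proof.
case: k => [|b] h.
  by rewrite fiber_size0; case: n h => [|[|]] // _; rewrite ?catalan0 ?catalan1.
have [cs [u s ->]] := fiber_size_block n b.
by rewrite block_histories_catalan ?s.
Qed.

Lemma fiber_size_almost_unbounded n :
  (fiber_size n.+2 n)%:R = catalan n.+2 - catalan n.
Proof.
case: n => [|b].
  by rewrite fiber_size0 catalan_rec 2!big_ord_recl big_ord0 /= catalan0 catalan1.
have [cs [u s ->]] := fiber_size_block b.+3 b.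
by rewrite block_histories_almost_unbounded ?s.
Qed.

(** * The power series equation *)

(** Products of power series are computed through polynomials that have the same
    coefficients up to degree [n], where ring identities are available. *)
Definition agree (n : nat) (u : fps) (p : {poly rat}) :=
  forall i, (i <= n)%N -> u i = p`_i.

Lemma agree_mul n u v p q :
  agree n u p -> agree n v q -> agree n (fps_mul u v) (p * q).
Proof.
move=> hu hv i hi; rewrite coefM; apply: eq_bigr => j _.
by have hj := ltn_ord j; rewrite hu ?hv //; lia.
Qed.

Lemma agree_sub n u v p q :
  agree n u p -> agree n v q -> agree n (fps_sub u v) (p - q).
Proof. by move=> hu hv i hi; rewrite coefB -hu // -hv. Qed.

Lemma agree_one n : agree n fps_one 1.
Proof. by move=> i _; rewrite coef1. Qed.

Lemma agree_X n : agree n fps_X 'X.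
Proof. by move=> i _; rewrite coefX. Qed.

Lemma agree_poly n u : agree n u (\poly_(i < n.+1) u i).
Proof. by move=> i hi; rewrite coef_poly ltnS hi. Qed.

Lemma size_fps_inv_seq u n : size (fps_inv_seq u n) = n.+1.
Proof. by elim: n => //= n ih; rewrite size_rcons ih. Qed.

Lemma nth_fps_inv_seq u n i : (i <= n)%N -> (fps_inv_seq u n)`_i = fps_inv u i.
Proof.
elim: n => [|n ih]; first by case: i.
rewrite leq_eqVlt => /predU1P[-> //|hi].
by rewrite /= nth_rcons size_fps_inv_seq hi ih.
Qed.

Lemma fps_invS u n : fps_inv u n.+1 =
  - ((u 0%N)^-1 * \sum_(i < n.+1) u (n.+1 - i)%N * fps_inv u i).
Proof.
rewrite {1}/fps_inv /= nth_rcons size_fps_inv_seq ltnn eqxx.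
congr (- (_ * _)); apply: eq_bigr => i _.
by rewrite nth_fps_inv_seq ?leq_ord.
Qed.

Lemma fps_mul_inv u : u 0%N != 0 -> fps_mul u (fps_inv u) =1 fps_one.
Proof.
move=> u0 [|n]; rewrite /fps_mul /fps_one /=.
  by rewrite big_ord1 /fps_inv /= mulfV.
rewrite (reindex_inj rev_ord_inj) big_ord_recr /= subnn fps_invS mulrN mulVKf //.
apply/eqP; rewrite subr_eq0; apply/eqP; apply: eq_bigr => i _.
by rewrite subSS subKn // ltnW.
Qed.

Lemma fps_mulX0 u : fps_mul fps_X u 0 = 0.
Proof. by rewrite /fps_mul big_ord1 mul0r. Qed.

Lemma fps_mulXS u n : fps_mul fps_X u n.+1 = u n.
Proof.
rewrite /fps_mul !big_ord_recl /= big1 => [|i _]; last by rewrite mul0r.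
by rewrite mul0r mul1r add0r addr0 subSS subn0.
Qed.

Lemma fps_mulXlS u v n : fps_mul (fps_mul fps_X u) v n.+1 = fps_mul u v n.
Proof.
rewrite {1}/fps_mul big_ord_recl /= fps_mulX0 mul0r add0r.
by apply: eq_bigr => i _; rewrite /= /bump leq0n add1n fps_mulXS subSS.
Qed.

Lemma fps_mulXl0 u v : fps_mul (fps_mul fps_X u) v 0 = 0.
Proof. by rewrite {1}/fps_mul big_ord1 /= fps_mulX0 mul0r. Qed.

Definition A101785_denominator (A : fps) : fps :=
  fps_sub fps_one (fps_mul (fps_mul fps_X fps_X) (fps_mul A A)).

(** Cancelling the factor x turns the equation into a recursion in which the
    right-hand side involves earlier coefficients only. *)
Lemma A101785_equationE A : A101785_equation A <->
  A 0%N = 1 /\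
  forall n, A n.+1 = fps_mul A (fps_inv (A101785_denominator A)) n.
Proof.
split=> [h|[h0 hS] [|n]]; last first.
- by rewrite hS /fps_add add0r /fps_div fps_mulXlS.
- by rewrite h0 /fps_add /fps_div fps_mulXl0 addr0.
split=> [|n]; first by rewrite h /fps_add /fps_div fps_mulXl0 addr0.
by rewrite h /fps_add add0r /fps_div fps_mulXlS.
Qed.

Lemma A101785_unique A B :
  A101785_equation A -> A101785_equation B -> B =1 A.
Proof.
move=> /A101785_equationE[A0 AS] /A101785_equationE[B0 BS] n.
have [m] := ubnP n; elim: m n => // m ih [|n]; first by rewrite A0 B0.
rewrite ltnS => hn.
have eAB i : (i <= n)%N -> B i = A i by move=> hi; apply: ih; lia.
have eM u v u' v' i : (forall j, (j <= n)%N -> u' j = u j) ->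
    (forall j, (j <= n)%N -> v' j = v j) -> (i <= n)%N ->
    fps_mul u' v' i = fps_mul u v i.
  move=> hu hv hi; apply: eq_bigr => j _.
  by have hj := ltn_ord j; rewrite hu ?hv //; lia.
have eV i : (i <= n)%N -> A101785_denominator B i = A101785_denominator A i.
  move=> hi; rewrite /A101785_denominator /fps_sub; congr (_ - _).
  by apply: (eM) => // j hj; apply: (eM).
rewrite AS BS; apply: (eM) => // i hi.
have [l] := ubnP i; elim: l i hi => // l ihl [|i] hi hl.
  by rewrite /fps_inv /= eV.
rewrite !fps_invS eV //; congr (- (_ * _)); apply: eq_bigr => j _.
by have hj := ltn_ord j; rewrite eV ?ihl //; lia.
Qed.

(** The power series 1 + x F. *)
Definition shift_fps (F : fps) : fps := fun n => if n is m.+1 then F m else 1.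

(** The polynomial is the expansion of A + x^2 A^2 F for A = 1 + x F, with [p] in
    the place of F. *)
Lemma cascade2_rec_coef (f : nat -> nat) (p : {poly rat}) n :
  f 0%N = 1%N -> (forall m, (0 < m)%N -> f m = cascade2_rec f m) ->
  agree n (fun m => (f m)%:R) p ->
  agree n (fun m => (f m)%:R)
    (1 + 'X * p + 'X^2 * p + 'X^3 * (p * p *+ 2) + 'X^4 * (p * p * p)).
Proof.
move=> f0 fS fp i hi.
set F : fps := fun n => (f n)%:R in fp *.
have pp := agree_mul fp fp; have ppp := agree_mul pp fp.
rewrite !coefD coef1 coefXM !coefXnM coefMn.
case: i hi => [|i] hi; first by rewrite f0 !addr0.
rewrite fS // /cascade2_rec 3!natrD [((_ < _) * _)%:R]natrM [(2 * _)%:R]natrM.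
rewrite subn1 /= -fp ?(ltnW hi) // add0r; congr (_ + _ + _ + _).
- case: i hi => [|i] hi; first by rewrite mul0r.
  by rewrite !subSS subn0 mul1r -fp //; lia.
- case: i hi => [|[|i]] hi; try by rewrite big_geq // mulr0.
  rewrite -[(i.+3 < 3)%N]/false !subSS !subn0 -pp; last by lia.
  rewrite mulr2n mulrDl mul1r big_mkord natr_sum.
  by congr (_ + _); apply: eq_bigr => j _; rewrite natrM.
- case: i hi => [|[|[|i]]] hi; try by rewrite big_geq.
  rewrite -[(i.+4 < 4)%N]/false !subSS !subn0 -ppp; last by lia.
  rewrite big_mkord natr_sum; apply: eq_bigr => j _; rewrite natrM; congr (_ * _).
  by rewrite big_mkord natr_sum; apply: eq_bigr => l _; rewrite natrM.
Qed.

(** The recursion says that A and (1 - x^2 A^2) F have the same coefficients;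
    multiplying by the inverse of 1 - x^2 A^2 leaves F. *)
Lemma shift_solution (f : nat -> nat) : f 0%N = 1%N ->
  (forall n, (0 < n)%N -> f n = cascade2_rec f n) ->
  A101785_equation (shift_fps (fun n => (f n)%:R)).
Proof.
move=> f0 fS; set F : fps := fun n => (f n)%:R; set A := shift_fps F.
apply/A101785_equationE; split=> // n; rewrite -[A n.+1]/(F n).
set V := A101785_denominator A.
pose p : {poly rat} := \poly_(i < n.+1) F i.
pose q : {poly rat} := 1 + 'X * p.
have Fp : agree n F p by exact: agree_poly.
have Aq : agree n A q.
  by case=> [|i] hi; rewrite coefD coef1 coefXM //= ?addr0 ?add0r // Fp // ltnW.
pose v : {poly rat} := 1 - 'X * 'X * (q * q).
have Vv : agree n V v.
  apply: agree_sub (@agree_one n) _.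
  by do !apply: agree_mul => //; exact: agree_X.
have V0 : V 0%N != 0.
  by rewrite /V /A101785_denominator /fps_sub /fps_one fps_mulXl0 subr0 oner_eq0.
have Avp : agree n A (v * p).
  move=> i hi; rewrite Aq // /v /q.
  have : F i = _ := cascade2_rec_coef f0 fS Fp hi; rewrite Fp //.
  have -> : 1 + 'X * p + 'X^2 * p + 'X^3 * (p * p *+ 2) + 'X^4 * (p * p * p) =
      (1 + 'X * p) + 'X * 'X * ((1 + 'X * p) * (1 + 'X * p)) * p by ring.
  rewrite mulrBl mul1r coefB [in X in X -> _]coefD => ->.
  by rewrite addrK.
pose w : {poly rat} := \poly_(i < n.+1) fps_inv V i.
have Vw : agree n (fps_inv V) w by exact: agree_poly.
have vw1 : agree n fps_one (v * w).
  by move=> i hi; rewrite -(fps_mul_inv V0); exact: (agree_mul Vv Vw).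
rewrite (agree_mul Avp Vw) // mulrAC mulrC Fp //.
rewrite -(agree_mul (u := fun i => p`_i) _ vw1) //.
rewrite (agree_mul (u := fun i => p`_i) (p := p) _ (@agree_one n)) //.
by rewrite mulr1.
Qed.

Theorem corollary6 :
  (forall n : nat, (1 <= n)%N -> fiber_size n 0 = 1%N) /\
  (forall n : nat, (1 <= n)%N -> (fiber_size n 1)%:R = motzkin n) /\
  (fiber_size 0 2 = 1%N /\
   (forall n : nat, (1 <= n)%N ->
      fiber_size n 2 =
        (fiber_size_int (n%:Z - 1) 2 + fiber_size_int (n%:Z - 2) 2
         + 2 * (\sum_(0 <= i < n - 2) fiber_size i 2 * fiber_size (n - 3 - i) 2)
         + \sum_(0 <= i < n - 3)
             (\sum_(0 <= j < i.+1) fiber_size j 2 * fiber_size (i - j) 2)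
             * fiber_size (n - 4 - i) 2)%N) /\
   (exists A : fps,
      A101785_equation A /\
      (forall B : fps, A101785_equation B -> B =1 A) /\
      (forall n : nat, (fiber_size n 2)%:R = A n.+1))) /\
  (forall n : nat, (2 <= n)%N ->
     (fiber_size n (n - 2))%:R = catalan n - catalan (n - 2)) /\
  (forall n k : nat, (1 <= n)%N -> (n - 1 <= k)%N ->
     (fiber_size n k)%:R = catalan n).
Proof.
split; first by move=> n _; exact: fiber_size0.
split; first by move=> n _; exact: fiber_size_motzkin.
split; last split.
- split; first exact: fiber_size_no_cars.
  split=> [n n1|].
    rewrite [LHS]fiber_size2_rec // /cascade2_rec; congr (_ + _ + _ + _)%N.
      by case: n n1 => // n _; rewrite subn1 (_ : n.+1%:Z - 1 = n) //; lia.
    case: n n1 => [|[|n]] // _.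
    by rewrite mul1n !subSS subn0 (_ : n.+2%:Z - 2 = n) //; lia.
  have hA := shift_solution (fiber_size_no_cars 2) fiber_size2_rec.
  exists (shift_fps (fun n => (fiber_size n 2)%:R)); split=> //.
  by split=> // B; exact: A101785_unique.
- move=> [|[|n]] // _; rewrite !subSS subn0; exact: fiber_size_almost_unbounded.
- by move=> n k _ h; apply: fiber_size_catalan; lia.
Qed.
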